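(* If $V=(V_1,\dots,V_k)$ is a doubly commuting $k$-tuple of isometries on a Hilbert space $\mathcal H$, that is, $V_iV_j=V_jV_i$ and $V_i^*V_j=V_jV_i^*$ for all $i\ne j$, then $V$ admits a unitary extension.
   Context: A unitary extension of $V$ is a $k$-tuple of (doubly) commuting unitaries $(\widehat V_1,\dots,\widehat V_k)$ on a Hilbert space $\mathcal K$ containing $\mathcal H$ (isometrically) such that $\widehat V_i|_{\mathcal H}=V_i$ for all $i$. *)

(* Defs.v *)
From HB Require Import structures.
From mathcomp Require Import all_boot all_order all_algebra.
From mathcomp Require Import sesquilinear.
From mathcomp Require Import complex.
From mathcomp Require Import all_classical all_reals all_analysis.

Set Implicit Arguments.
Unset Strict Implicit.
Unset Printing Implicit Defensive.

Import Order.TTheory GRing.Theory Num.Theory.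
Import numFieldNormedType.Exports.

Local Open Scope classical_set_scope.
Local Open Scope ring_scope.

(* The forms [{dot H for Num.conj}] are linear in the first argument and
   conjugate-linear in the second. *)
HB.mixin Record NormedModule_isInnerProduct (R : realType) H
    & NormedModule R[i] H := {
  inner : {dot H for (@Num.conj R[i])};
  norm_inner : forall x : H, `|x| = sqrtC (inner x x)
}.

#[short(type="hilbertType")]
HB.structure Definition Hilbert (R : realType) :=
  {H of CompleteNormedModule R[i] H & NormedModule_isInnerProduct R H}.

Section Operators.
Variable R : realType.
Implicit Types H K : hilbertType R.

(* For a bounded linear [T] the set below is a singleton for every [y], by the
   Riesz representation theorem and the definiteness of the inner product; for
   other maps the value may be arbitrary. *)
Definition adjoint H K (T : H -> K) (y : K) : H :=
  get [set z : H | forall x : H, inner (T x) y = inner x z].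

Definition is_isometry H K (T : {linear H -> K}) : Prop :=
  forall x : H, `|T x| = `|x|.

(* Without continuity [adjoint U] need not be the adjoint of [U]. *)
Definition is_unitary H (U : {linear H -> H}) : Prop :=
  [/\ continuous U,
      adjoint U \o U =1 id &
      U \o adjoint U =1 id].

Definition doubly_commuting H (k : nat) (V : 'I_k -> {linear H -> H}) : Prop :=
  forall i j : 'I_k, i != j ->
    V i \o V j =1 V j \o V i /\
    adjoint (V i) \o V j =1 V j \o adjoint (V i).

(* [J] is the isometric inclusion of [H] into [K]. *)
Definition is_unitary_extension H (k : nat) (V : 'I_k -> {linear H -> H})
    K (J : {linear H -> K}) (U : 'I_k -> {linear K -> K}) : Prop :=
  [/\ is_isometry J,
      forall i, is_unitary (U i),
      doubly_commuting U &
      forall i, U i \o J =1 J \o V i].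

Definition admits_unitary_extension H (k : nat) (V : 'I_k -> {linear H -> H})
    : Prop :=
  exists (K : hilbertType R) (J : {linear H -> K})
    (U : 'I_k -> {linear K -> K}), is_unitary_extension V J U.

End Operators.

(* Main.v *)
(* Let W be the product of the V_i and A = W^*, a contraction.  In a minimal
   unitary extension with commuting U_i and U = prod_i U_i, the union of the
   increasing subspaces U^-n H is dense, and a vector is determined by the
   projections h_n of its images under U^n to H.  These sequences are the
   bounded ones with A h_(n+1) = h_n, and |h_n| increases to the norm of the
   vector.  Conversely, such sequences form a Hilbert space K, in which
   x |-> (W^n x)_n embeds H isometrically.  On K, the operator U_i^-1 acts by
   (h_n) |-> (V_i^* h_n) and U_i by (h_n) |-> ((prod_(j != i) V_j^* ) h_(n+1)).
   These are mutually inverse contractions, so U_i is unitary; its adjoint is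
   its inverse, so the U_i doubly commute because they commute. *)
From HB Require Import structures.
Require Import Defs.
From mathcomp Require Import all_boot all_order all_algebra.
From mathcomp Require Import sesquilinear complex ring lra.
From mathcomp Require Import all_classical all_reals all_analysis.
Import Order.TTheory GRing.Theory Num.Theory.
Import numFieldNormedType.Exports.

Set Implicit Arguments.
Unset Strict Implicit.
Unset Printing Implicit Defensive.

Local Open Scope classical_set_scope.
Local Open Scope ring_scope.

(** * Inner product identities and orthogonality from minimality *)

Section InnerProduct.
Variables (R : realType) (H : hilbertType R).
Implicit Types (x y u w : H) (a : R[i]).

Lemma innerDl x y u : inner (x + y) u = inner x u + inner y u.
Proof. exact: linearDl. Qed.

Lemma innerDr u x y : inner u (x + y) = inner u x + inner u y.
Proof. exact: linearDr. Qed.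

Lemma innerNl x u : inner (- x) u = - inner x u.
Proof. exact: linearNl. Qed.

Lemma innerNr x u : inner x (- u) = - inner x u.
Proof. exact: linearNr. Qed.

Lemma innerZl a x u : inner (a *: x) u = a * inner x u.
Proof. exact: linearZl_LR. Qed.

Lemma innerZr a x u : inner x (a *: u) = a^* * inner x u.
Proof. exact: linearZr_LR. Qed.

Lemma innerC x y : inner x y = (inner y x)^*.
Proof. by rewrite hermC expr0 mul1r. Qed.

Lemma inner_id x : inner x x = `|x| ^+ 2.
Proof. by rewrite norm_inner sqrtCK. Qed.

Lemma inner_inj x y : (forall u, inner u x = inner u y) -> x = y.
Proof.
move=> xy; apply/eqP; rewrite -subr_eq0 -normr_eq0 -sqrf_eq0 -inner_id.
by rewrite innerDr innerNr xy subrr.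
Qed.

Lemma polarization x y : inner x y =
  4^-1 * (`|x + y| ^+ 2 - `|x - y| ^+ 2
          + 'i * `|x + 'i *: y| ^+ 2 - 'i * `|x - 'i *: y| ^+ 2).
Proof.
rewrite -!inner_id !(innerDl, innerDr, innerNl, innerNr, innerZl, innerZr).
rewrite conjCi.
apply/eqP; rewrite -subr_eq0; apply/eqP.
(* [field] treats ['i] as an indeterminate, so the difference of the two sides is first put as a
   multiple of ['i ^+ 2 + 1]. *)
transitivity (('i ^+ 2 + 1) * (inner x y - inner y x) / 2 : R[i]).
  by field.
by rewrite sqrCi addNr !mul0r.
Qed.

Lemma normsqD x y :
  `|x + y| ^+ 2 = `|x| ^+ 2 + `|y| ^+ 2 + (inner x y + inner y x).
Proof. by rewrite -!inner_id !(innerDl, innerDr); ring. Qed.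

Lemma normsqB x y :
  `|x - y| ^+ 2 = `|x| ^+ 2 + `|y| ^+ 2 - (inner x y + inner y x).
Proof.
by rewrite -!inner_id !(innerDl, innerDr, innerNl, innerNr); ring.
Qed.

Lemma parallelogram x y :
  `|x + y| ^+ 2 + `|x - y| ^+ 2 = 2 * `|x| ^+ 2 + 2 * `|y| ^+ 2.
Proof. by rewrite normsqD normsqB; ring. Qed.

(* Testing minimality at w - (<w, u> / |u|^2) u would make |w| smaller. *)
Lemma inner_eq0_of_min w u :
  (forall a, `|w| ^+ 2 <= `|w - a *: u| ^+ 2) -> inner w u = 0.
Proof.
move=> wmin; have [->|u0] := eqVneq u 0; first exact: linear0r.
have n0 : `|u| ^+ 2 != 0 by rewrite sqrf_eq0 normr_eq0.
have := wmin (inner w u / `|u| ^+ 2).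
rewrite normsqB normrZ exprMn normf_div innerZl innerZr.
rewrite (ger0_norm (exprn_ge0 _ _)) //.
rewrite rmorphM/= fmorphV/= rmorphXn/= (CrealP (normr_real _)).
rewrite -(innerC u w) expr_div_n.
have wu : `|inner w u| ^+ 2 = inner w u * inner u w by rewrite normCK -innerC.
rewrite wu.
have -> : `|w| ^+ 2 + inner w u * inner u w / (`|u| ^+ 2) ^+ 2 * `|u| ^+ 2 -
  (inner u w / `|u| ^+ 2 * inner w u + inner w u / `|u| ^+ 2 * inner u w) =
  `|w| ^+ 2 - `|inner w u| ^+ 2 / `|u| ^+ 2.
  by rewrite wu; field; rewrite -normr_eq0 in u0.
rewrite lerDl oppr_ge0 => wu_le0.
apply/eqP; rewrite -normr_eq0 -sqrf_eq0 eq_le exprn_ge0 // andbT.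
rewrite -(pmulr_lle0 _ (x := (`|u| ^+ 2)^-1)) //.
by rewrite invr_gt0 exprn_gt0 ?normr_gt0.
Qed.

End InnerProduct.

Section Isometry.
Variables (R : realType) (H K : hilbertType R) (T : {linear H -> K}).
Hypothesis isoT : is_isometry T.

(** Polarization writes the inner product in terms of norms of linear combinations, and T preserves
    those. *)
Lemma isometry_inner x y : inner (T x) (T y) = inner x y.
Proof. by rewrite !polarization -!linearZ -!linearD -!linearB !isoT. Qed.

End Isometry.

(* Only the topology and the norm are copied: the canonical lmodType structure
   of R[i] has scalars in R. *)
#[non_forgetful_inheritance]
HB.instance Definition _ (R : realType) :=
  PseudoMetricNormedZmod.copy R[i] R[i]^o.

(** * Passing limits between the real and the complex numbers *)

Section ComplexLimits.
Variables (R : realType) (T : Type) (F : set_system T).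
Context {FF : ProperFilter F}.

Lemma cvg_Re (f : T -> R[i]) (l : R[i]) :
  f @ F --> l -> complex.Re (f x) @[x --> F] --> complex.Re l.
Proof.
move=> /cvgrPdist_lt fl; apply/cvgrPdist_lt => e e0.
near=> x; rewrite -raddfB -ltcR (le_lt_trans (y := `|l - f x|)) //.
  exact: normc_ge_Re.
by near: x; apply: fl; rewrite ltcR.
Unshelve. all: by end_near. Qed.

Lemma cvg_real_complex (f : T -> R) (l : R) :
  f @ F --> l -> (f x)%:C%C @[x --> F] --> l%:C%C.
Proof.
move=> /cvgrPdist_lt fl; apply/cvgrPdist_lt => e e0.
(* Radii are elements of [R[i]]; a positive one is real. *)
have eE : e = (complex.Re e)%:C%C by rewrite RRe_real ?gtr0_real.
near=> x; rewrite -rmorphB/= normc_def/=  expr0n addr0 sqrtr_sqr eE ltcR.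
by near: x; apply: fl; rewrite -ltcR -eE.
Unshelve. all: by end_near. Qed.

End ComplexLimits.

Lemma contraction_continuous (R : realType) (H K : hilbertType R)
    (T : {linear H -> K}) : (forall x, `|T x| <= `|x|) -> continuous T.
Proof.
move=> cT x; apply/cvgrPdist_lt => e e0; near=> y.
rewrite -linearB; apply: le_lt_trans (cT _) _.
by near: y; apply: cvgr_dist_lt.
Unshelve. all: by end_near. Qed.


(** * Existence of the adjoint of an isometry, by nearest points in its range *)

Section Adjoint.
Variables (R : realType) (H K : hilbertType R) (T : {linear H -> K}).
Hypothesis isoT : is_isometry T.

(** Norms live in [R[i]]; the real part brings the squared distance into R, where infima exist. *)
Let sqdist (y : K) (x : H) : R := complex.Re (`|y - T x| ^+ 2).

Let sqdistE y x : (sqdist y x)%:C%C = `|y - T x| ^+ 2.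
Proof. by rewrite RRe_real // rpredX ?normr_real. Qed.

Let sqdist_ge0 y x : 0 <= sqdist y x.
Proof. by rewrite -lecR sqdistE exprn_ge0. Qed.

Let d (y : K) := inf (range (sqdist y)).

Let has_inf_sqdist y : has_inf (range (sqdist y)).
Proof. by split; [exists (sqdist y 0), 0|exists 0 => _ [x _ <-]]. Qed.

Let d_le y x : d y <= sqdist y x.
Proof. by apply: ge_inf; [case: (has_inf_sqdist y)|exists x]. Qed.

Let near_min y (e : R) := [set x | sqdist y x < d y + e].

(** Parallelogram law for y - T x1 and y - T x2: their sum is twice y - T m with m the midpoint,
    whose squared distance is at least [d y]. As T is isometric, the bound holds in H itself. *)
Let near_min_dist y (e1 e2 : R) x1 x2 : near_min y e1 x1 -> near_min y e2 x2 ->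
  `|x1 - x2| ^+ 2 < (2 * (e1 + e2))%:C%C.
Proof.
rewrite /near_min/= => x1e x2e.
have := parallelogram (y - T x1) (y - T x2).
have -> : y - T x1 - (y - T x2) = T (x2 - x1).
  by rewrite opprB addrC addrA subrK linearB.
have -> : y - T x1 + (y - T x2) = 2 *: (y - T (2^-1 *: (x1 + x2))).
  rewrite linearZ/= scalerBr scalerA divff ?pnatr_eq0// scale1r linearD.
  by rewrite scaler_nat mulr2n opprD addrACA.
rewrite isoT distrC normrZ exprMn -!sqdistE => E.
have -> : `|x1 - x2| ^+ 2 = (2 * sqdist y x1 + 2 * sqdist y x2
   - 4 * sqdist y (2^-1 *: (x1 + x2)))%:C%C.
  apply: (addrI (`|2| ^+ 2 * (sqdist y (2^-1 *: (x1 + x2)))%:C%C)).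
  rewrite E !(rmorphB, rmorphD, rmorphM, rmorph_nat)/=.
  by rewrite ger0_norm ?ler0n//; ring.
rewrite ltcR.
have := d_le y (2^-1 *: (x1 + x2)); lra.
Qed.

(** The sets of near-minimizers generate a Cauchy filter on H, and by continuity of the distance its
    limit attains the infimum. *)
Let minimizer_ex y : exists z, forall x, `|y - T z| <= `|y - T x|.
Proof.
pose F := filter_from [set e : R | 0 < e] (near_min y).
have FF : ProperFilter F.
  apply: filter_from_proper => [|e e0]; last first.
    have [_ [x _ <-] xe] := inf_adherent e0 (has_inf_sqdist y).
    by exists x.
  apply: filter_from_filter => [|e1 e2 e10 e20]; first by exists 1 => /=.
  exists (Num.min e1 e2) => /=; first by rewrite lt_min e10.
  move=> x; rewrite /near_min/= => xe; split; apply: lt_le_trans xe _;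
  by rewrite lerD2l ge_min lexx ?orbT.
have /cauchy_cvg/cvg_ex[z Fz] : cauchy F.
  apply: cauchy_exP => e e0.
  have eE : e = (complex.Re e)%:C%C by rewrite RRe_real ?gtr0_real.
  have r0 : 0 < complex.Re e by rewrite -ltcR -eE.
  (* With slack e^2/4 on both points, [near_min_dist] bounds the squared distance by 2 (e^2/4 +
     e^2/4) = e^2. *)
  have s0 : 0 < complex.Re e ^+ 2 / 4 by rewrite divr_gt0 ?exprn_gt0.
  have [_ [x _ <-] xe] := inf_adherent s0 (has_inf_sqdist y).
  exists x; exists (complex.Re e ^+ 2 / 4) => // x' x'e.
  rewrite -ball_normE/= -ltr_sqr ?nnegrE// ?(ltW e0)//.
  apply: lt_le_trans (near_min_dist xe x'e) _.
  rewrite eE -rmorphXn/= lecR; lra.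
exists z => x; rewrite -ler_sqr ?nnegrE// -!sqdistE lecR.
apply: le_trans (d_le y x).
have cz : sqdist y x @[x --> F] --> sqdist y z.
  apply: cvg_Re; rewrite expr2; under eq_fun do rewrite expr2.
  have c1 : `|y - T x| @[x --> F] --> `|y - T z|.
    apply: cvg_norm; apply: cvgB; first exact: cvg_cst.
    apply: cvg_comp Fz _; apply: contraction_continuous.
    by move=> u; rewrite isoT.
  exact: cvgM.
apply/ler_addgt0Pr => e e0; apply: cvgr_to_le cz _.
by exists e => // u /ltW.
Qed.

(** If T z is the point of the range nearest to y, then y - T z is orthogonal to the range, so <T x,
    y> = <T x, T z> = <x, z>. Thus the set from which [adjoint] picks is nonempty. *)
Lemma isometry_adjointP x y : inner (T x) y = inner x (adjoint T y).
Proof.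
suff /getPex : exists z, forall x, inner (T x) y = inner x z by [].
have [z zmin] := minimizer_ex y; exists z => {}x.
rewrite -[y](subrK (T z)) addrC innerDr isometry_inner//.
rewrite (innerC (T x)) (inner_eq0_of_min (w := y - T z)) ?conjC0 ?addr0// => a.
rewrite -addrA -opprD -linearZ -linearD.
by rewrite ler_sqr ?nnegrE.
Qed.

End Adjoint.

(** Bundled so that the inverse limit type and its instances can take a contraction as their
    parameter. *)
Record linear_contraction (R : realType) (H : hilbertType R) :=
  LinearContraction {
  linear_contraction_fun :> {linear H -> H};
  contractionP : forall x, `|linear_contraction_fun x| <= `|x|
}.

(** * The adjoint of an isometry as a linear contraction *)

Section AdjointContraction.
Variables (R : realType) (H : hilbertType R) (T : {linear H -> H}).
Hypothesis isoT : is_isometry T.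

Lemma isometry_adjointK : cancel T (adjoint T).
Proof.
move=> x; apply: inner_inj => u.
by rewrite -isometry_adjointP// isometry_inner.
Qed.

Lemma isometry_adjoint_is_linear : linear (adjoint T).
Proof.
move=> a x y; apply: inner_inj => u.
by rewrite innerDr innerZr -!isometry_adjointP// innerDr innerZr.
Qed.

(** Pythagoras: x is the orthogonal sum of T T^* x, of norm |T^* x|, and x - T T^* x. *)
Lemma isometry_adjoint_contraction x : `|adjoint T x| <= `|x|.
Proof.
set y := adjoint T x.
have ort : inner (T y) (x - T y) = 0.
  by rewrite innerDr innerNr isometry_adjointP// isometry_inner// subrr.
rewrite -ler_sqr ?nnegrE// -isoT -[x in leRHS](subrK (T y)) normsqD ort.
by rewrite innerC ort conjC0 !addr0 lerDr exprn_ge0.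
Qed.

End AdjointContraction.

(** * The Hilbert space of bounded coherent sequences *)

Section InverseLimit.
Variables (R : realType) (H : hilbertType R) (A : linear_contraction H).

Definition invlim_pred : {pred nat -> H} := fun h =>
  `[< (forall n, A (h n.+1) = h n) /\ exists M, forall n, `|h n| <= M >].

Fact invlim_submod : submod_closed invlim_pred.
Proof.
split=> [|a x y /asboolP[xA [M xM]] /asboolP[yA [N yN]]]; apply/asboolP; split.
- by move=> n; exact: linear0.
- by exists 0 => n; rewrite normr0.
- by move=> n; rewrite !fctE linearP xA yA.
- exists (`|a| * M + N) => n; rewrite !fctE.
  by rewrite (le_trans (ler_normD _ _))// lerD// normrZ ler_wpM2l.
Qed.

HB.instance Definition _ :=
  GRing.isSubmodClosed.Build R[i] (nat -> H) invlim_pred invlim_submod.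

Record invlim := Invlim {
  invlim_fun :> nat -> H;
  _ : invlim_fun \in invlim_pred
}.

HB.instance Definition _ := [isSub for invlim_fun].
HB.instance Definition _ := [Choice of invlim by <:].
HB.instance Definition _ := [SubChoice_isSubLmodule of invlim by <:].

Implicit Types x y : invlim.

Lemma invlimP x y : (forall n, x n = y n) -> x = y.
Proof. by move=> xy; apply/val_inj/funext. Qed.

Lemma invlimD x y n : (x + y) n = x n + y n. Proof. by []. Qed.
Lemma invlimN x n : (- x) n = - x n. Proof. by []. Qed.
Lemma invlimZ a x n : (a *: x) n = a *: x n. Proof. by []. Qed.

Lemma invlimS x n : A (x n.+1) = x n.
Proof. by have /asboolP[] := valP x. Qed.

Let rnorm x n : R := complex.Re `|x n|.

Let rnormE x n : (rnorm x n)%:C%C = `|x n|.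
Proof. by rewrite RRe_real ?normr_real. Qed.

Let rnorm_ub x : has_ubound (range (rnorm x)).
Proof.
have /asboolP[_ [M xM]] := valP x.
(* M dominates a norm, hence is real and equal to its real part. *)
exists (complex.Re M) => _ [n _ <-]; rewrite -lecR rnormE RRe_real ?xM//.
by rewrite ger0_real// (le_trans (normr_ge0 _) (xM 0)).
Qed.

Let rnorm_homo x : {homo rnorm x : n m / (n <= m)%N >-> n <= m}.
Proof.
apply: homo_leq => [n|n m p|n]; [exact: lexx|exact: le_trans|].
by rewrite -lecR !rnormE -invlimS contractionP.
Qed.

(** This supremum is also the limit of the [|x n|], which are nondecreasing because A is a
    contraction. *)
Definition invlim_norm x : R[i] := (sup (range (rnorm x)))%:C%C.

Lemma norm_le_invlim x n : `|x n| <= invlim_norm x.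
Proof.
rewrite -rnormE lecR; apply: ub_le_sup; last by exists n.
exact: rnorm_ub.
Qed.

Lemma invlim_norm_le x (M : R[i]) :
  (forall n, `|x n| <= M) -> invlim_norm x <= M.
Proof.
move=> xM; have /RRe_real ME : M \is Num.real.
  by rewrite ger0_real// (le_trans (normr_ge0 _) (xM 0)).
rewrite -ME lecR; apply: ge_sup; first by exists (rnorm x 0), 0.
by move=> _ [n _ <-]; rewrite -lecR rnormE ME.
Qed.

Lemma cvg_invlim_norm x : `|x n| @[n --> \oo] --> invlim_norm x.
Proof.
under eq_fun do rewrite -rnormE.
by apply: cvg_real_complex; apply: nondecreasing_cvgn.
Qed.

Fact invlim_normD x y : invlim_norm (x + y) <= invlim_norm x + invlim_norm y.
Proof.
apply: invlim_norm_le => n; rewrite invlimD (le_trans (ler_normD _ _))//.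
by rewrite lerD// norm_le_invlim.
Qed.

Let normZ_le a x : invlim_norm (a *: x) <= `|a| * invlim_norm x.
Proof.
apply: invlim_norm_le => n.
by rewrite invlimZ normrZ ler_wpM2l// norm_le_invlim.
Qed.

(** For nonzero a, the reverse inequality is [normZ_le] applied to a^-1 and [a *: x]. *)
Fact invlim_normZ a x : invlim_norm (a *: x) = `|a| * invlim_norm x.
Proof.
have [->|a0] := eqVneq a 0.
  rewrite scale0r normr0 mul0r; apply/eqP; rewrite eq_le.
  rewrite -{1}(mul0r (invlim_norm 0)) -{1}(normr0 R[i]) -{1}(scale0r 0).
  rewrite normZ_le.
  by rewrite (le_trans (normr_ge0 _) (norm_le_invlim _ 0)).
apply/eqP; rewrite eq_le normZ_le /=.
rewrite -ler_pdivlMl ?normr_gt0// -normfV -{1}(scalerK a0 x).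
exact: normZ_le.
Qed.

Fact invlim_norm0_eq0 x : invlim_norm x = 0 -> x = 0.
Proof.
move=> x0; apply: invlimP => n; apply/eqP.
by rewrite -normr_eq0 eq_le normr_ge0 -x0 norm_le_invlim.
Qed.

HB.instance Definition _ := Lmodule_isNormed.Build R[i] invlim
  invlim_normD invlim_normZ invlim_norm0_eq0.

Lemma invlim_normE x : `|x| = invlim_norm x.
Proof. by []. Qed.

(** Each coordinate is dominated by the norm, so coordinates converge, to g say. Continuity of A
    makes g coherent, and the estimate [g_dist], uniform in n, gives both boundedness of g and
    convergence in norm. *)
Fact invlim_complete (F : set_system invlim) :
  ProperFilter F -> cauchy F -> cvg F.
Proof.
move=> FF /cauchy_ballP Fc.
have cF n : cvg ((x : invlim) n @[x --> F]).
  apply/cauchy_cvgP/cauchy_ballP => e e0; rewrite near_map2.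
  apply: filterS (Fc e e0) => -[x y] /=.
  rewrite -!ball_normE/= -invlimN -invlimD.
  exact: le_lt_trans (norm_le_invlim _ _).
pose g n := lim ((x : invlim) n @[x --> F]).
have g_dist x e n : F (ball x e) -> `|x n - g n| <= e.
  move=> Fx; apply/ler_addgt0Pr => d d0; near F => y.
  rewrite -(subrK (y n) (x n)) -addrA (le_trans (ler_normD _ _))// lerD//.
    rewrite -invlimN -invlimD (le_trans (norm_le_invlim _ _))// -invlim_normE.
    have : ball x e y by near: y.
    by rewrite -ball_normE => /ltW.
  rewrite distrC ltW//; near: y.
  by have /cvgrPdist_lt := cF n; exact.
have gA n : A (g n.+1) = g n.
  have c : (x : invlim) n @[x --> F] --> A (g n.+1).
    under eq_fun do rewrite -invlimS.
    apply: cvg_comp (cF n.+1) _.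
    exact: contraction_continuous (@contractionP _ _ A) _.
  by apply/esym; apply: cvg_lim c; exact: norm_hausdorff.
have g_in : g \in invlim_pred.
  apply/asboolP; split=> //.
  have [x Fx] : exists x, F (ball x 1).
    by near F => x; exists x; near: x; apply: nearP_dep; apply: Fc.
  exists (invlim_norm x + 1) => n; rewrite -(subrK (x n) (g n)) addrC.
  by rewrite (le_trans (ler_normD _ _))// lerD ?norm_le_invlim// distrC g_dist.
apply/cvg_ex; exists (Invlim g_in); apply/cvgrPdist_le => e e0.
near=> x; rewrite distrC invlim_normE; apply: invlim_norm_le => n.
rewrite invlimD invlimN; apply: g_dist.
by near: x; apply: nearP_dep; exact: Fc.
Unshelve. all: by end_near. Qed.

HB.instance Definition _ := Uniform_isComplete.Build invlim invlim_complete.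

Definition invlim_inner (x y : invlim) : R[i] :=
  lim (inner (x n) (y n) @[n --> \oo]).

(** By polarization the inner products are a fixed combination of four squared norms, each
    convergent. *)
Lemma cvg_invlim_inner x y :
  inner (x n) (y n) @[n --> \oo] --> invlim_inner x y.
Proof.
have csq (u : invlim) : `|u n| ^+ 2 @[n --> \oo] --> invlim_norm u ^+ 2.
  rewrite expr2; under eq_fun do rewrite expr2.
  by apply: cvgM; exact: cvg_invlim_norm.
suff : cvg (inner (x n) (y n) @[n --> \oo]) by [].
under eq_fun do rewrite polarization.
apply: is_cvgM; first exact: is_cvg_cst.
apply: is_cvgB; last first.
  apply: is_cvgM; first exact: is_cvg_cst.
  by apply/cvg_ex; eexists; exact: (csq (x - 'i *: y)).
apply: is_cvgD; last first.
  apply: is_cvgM; first exact: is_cvg_cst.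
  by apply/cvg_ex; eexists; exact: (csq (x + 'i *: y)).
apply: is_cvgB.
  by apply/cvg_ex; eexists; exact: (csq (x + y)).
by apply/cvg_ex; eexists; exact: (csq (x - y)).
Qed.

Let invlim_inner_eq x y l :
  inner (x n) (y n) @[n --> \oo] --> l -> invlim_inner x y = l.
Proof. by apply: cvg_lim; exact: norm_hausdorff. Qed.

Fact invlim_innerC x y : invlim_inner x y = (invlim_inner y x)^*.
Proof.
apply: invlim_inner_eq; under eq_fun do rewrite innerC.
apply/cvgrPdist_lt => e e0.
have /cvgrPdist_lt/(_ e e0) := @cvg_invlim_inner y x.
by apply: filterS => n; rewrite -rmorphB norm_conjC.
Qed.

Fact invlim_inner_linear y : linear_for *%R (invlim_inner^~ y).
Proof.
move=> a x x' /=; apply: invlim_inner_eq.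
under eq_fun do rewrite invlimD invlimZ innerDl innerZl.
by apply: cvgD; [apply: cvgMl_tmp|]; exact: cvg_invlim_inner.
Qed.

Fact invlim_inner_bilinear :
  bilinear_for *%R (Num.conj \; *%R) invlim_inner.
Proof.
split=> [y|x a y y']; first exact: invlim_inner_linear.
rewrite invlim_innerC invlim_inner_linear rmorphD rmorphM/=.
by rewrite -!invlim_innerC.
Qed.

HB.instance Definition _ := bilinear_isBilinear.Build R[i] invlim invlim R[i]
  *%R (Num.conj \; *%R) invlim_inner invlim_inner_bilinear.

Lemma invlim_inner_id x : invlim_inner x x = `|x| ^+ 2.
Proof.
apply: invlim_inner_eq; under eq_fun do rewrite inner_id expr2.
by rewrite expr2; apply: cvgM; exact: cvg_invlim_norm.
Qed.

Fact invlim_inner_hermitian x y :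
  invlim_inner x y = (-1) ^+ false * (invlim_inner y x)^*.
Proof. by rewrite expr0 mul1r -invlim_innerC. Qed.

HB.instance Definition _ := isHermitianSesquilinear.Build R[i] invlim false
  (@Num.conj R[i]) invlim_inner invlim_inner_hermitian.

Fact invlim_inner_gt0 x : x != 0 -> 0 < invlim_inner x x.
Proof. by move=> x0; rewrite invlim_inner_id exprn_gt0// normr_gt0. Qed.

HB.instance Definition _ :=
  isDotProduct.Build R[i] invlim invlim_inner invlim_inner_gt0.

Fact invlim_norm_inner x : `|x| = sqrtC (invlim_inner x x).
Proof. by rewrite invlim_inner_id sqrCK. Qed.

HB.instance Definition _ := NormedModule_isInnerProduct.Build R invlim
  invlim_norm_inner.


End InverseLimit.

(** * Unitaries from inverse contractions, and maps into the inverse limit *)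

Lemma isometry_adjoint_is_contraction (R : realType) (H : hilbertType R)
    (T : {linear H -> H}) :
  is_isometry T -> exists A : linear_contraction H, A =1 adjoint T.
Proof.
move=> isoT.
pose lin := GRing.isLinear.Build _ _ _ _ _ (isometry_adjoint_is_linear isoT).
pose A : {linear H -> H} := HB.pack (adjoint T) lin.
by exists (@LinearContraction _ _ A (isometry_adjoint_contraction isoT)).
Qed.

(** U is isometric since |x| = |U' U x| <= |U x| <= |x|; then <U u, y> = <U u, U U' y> = <u, U'
    y>. *)
Lemma contraction_inverse_unitary (R : realType) (K : hilbertType R)
    (U U' : {linear K -> K}) :
    (forall x, `|U x| <= `|x|) -> (forall x, `|U' x| <= `|x|) ->
    cancel U U' -> cancel U' U ->
  Defs.is_unitary U /\ adjoint U =1 U'.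
Proof.
move=> cU cU' UK U'K.
have isoU : is_isometry U.
  by move=> x; apply/eqP; rewrite eq_le cU -{1}(UK x) cU'.
have adjU : adjoint U =1 U'.
  move=> y; apply: inner_inj => u.
  by rewrite -isometry_adjointP// -{1}(U'K y) isometry_inner.
split=> //; split; first exact: contraction_continuous.
- by move=> x /=; rewrite adjU UK.
- by move=> x /=; rewrite adjU U'K.
Qed.

Section InverseLimitMaps.
Variables (R : realType) (H : hilbertType R) (A : linear_contraction H).

(** Covers both kinds of operators on the limit: m = 1 for the extensions and m = 0 for their
    inverses. *)
Lemma invlim_lift (B : linear_contraction H) (m : nat) :
    (forall x, A (B x) = B (A x)) ->
  exists2 U : {linear invlim A -> invlim A},
    (forall x n, U x n = B (x (m + n)%N)) & forall x, `|U x| <= `|x|.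
Proof.
move=> AB.
have fP (x : invlim A) : (fun n => B (x (m + n)%N)) \in invlim_pred A.
  apply/asboolP; split=> [n|]; first by rewrite AB addnS invlimS.
  by exists `|x| => n; rewrite (le_trans (contractionP _ _))// norm_le_invlim.
pose f x := Invlim (fP x).
have f_linear : linear f.
  by move=> a x y; apply: invlimP => n; exact: linearP.
pose lin := GRing.isLinear.Build _ _ _ _ f f_linear.
pose U : {linear invlim A -> invlim A} := HB.pack f lin.
exists U => // x; rewrite invlim_normE; apply: invlim_norm_le => n.
by rewrite (le_trans (contractionP _ _))// norm_le_invlim.
Qed.

(** A W = 1 makes the orbit of x coherent, and all its terms have norm |x|. *)
Lemma invlim_embed (W : {linear H -> H}) : is_isometry W -> cancel W A ->
  exists2 J : {linear H -> invlim A},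
    (forall x n, J x n = iter n W x) & is_isometry J.
Proof.
move=> isoW WK.
have iterW n x : `|iter n W x| = `|x| by elim: n => //= n; rewrite isoW.
have fP x : (fun n => iter n W x) \in invlim_pred A.
  apply/asboolP; split=> [n|]; first by rewrite iterS WK.
  by exists `|x| => n; rewrite iterW.
pose f x := Invlim (fP x).
have f_linear : linear f.
  move=> a x y; apply: invlimP => n; rewrite invlimD invlimZ /=.
  by elim: n => //= n ->; rewrite linearP.
pose lin := GRing.isLinear.Build _ _ _ _ f f_linear.
pose J : {linear H -> invlim A} := HB.pack f lin.
exists J => // x; apply/eqP; rewrite eq_le; apply/andP; split.
  by rewrite invlim_normE; apply: invlim_norm_le => n /=; rewrite iterW.
exact: (norm_le_invlim (J x) 0).
Qed.

End InverseLimitMaps.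

(** * Products of commuting families of operators *)

Section CommutingProduct.
Variables (R : pzRingType) (H : lmodType R) (I : eqType).
Variable T : I -> {linear H -> H}.
Hypothesis commT : forall i j x, T i (T j x) = T j (T i x).

(** Indexed by a list so that [rem i s] gives the product without the factor i. *)
Definition comp_seq (s : seq I) : {linear H -> H} :=
  foldr (fun i (f : {linear H -> H}) => T i \o f : {linear H -> H}) idfun s.

Lemma comp_seq_comm (S : H -> H) s x : (forall i y, S (T i y) = T i (S y)) ->
  S (comp_seq s x) = comp_seq s (S x).
Proof. by move=> ST; elim: s => //= i s IHs; rewrite ST IHs. Qed.

Lemma comp_seqC s t x :
  comp_seq s (comp_seq t x) = comp_seq t (comp_seq s x).
Proof.
by apply: comp_seq_comm => i y; rewrite -(comp_seq_comm (S := T i)).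
Qed.

Lemma comp_seq_rem i s x :
  i \in s -> comp_seq s x = T i (comp_seq (rem i s) x).
Proof.
elim: s => //= j s IHs; rewrite inE eq_sym; case: eqP => [->//|_ /= si].
by rewrite IHs// commT.
Qed.

End CommutingProduct.

(** Both products run in the same order; commutativity of the S i moves each one next to its T i. *)
Lemma comp_seq_cancel (R : pzRingType) (H : lmodType R) (I : eqType)
    (T S : I -> {linear H -> H}) s :
    (forall i j x, S i (S j x) = S j (S i x)) ->
    (forall i, cancel (T i) (S i)) ->
  cancel (comp_seq T s) (comp_seq S s).
Proof.
move=> commS TK x; elim: s => //= i s IHs.
by rewrite (comp_seq_comm (S := S i))// TK.
Qed.

Lemma comp_seq_contraction (R : realType) (H : hilbertType R) (I : eqType)
    (T : I -> linear_contraction H) s x : `|comp_seq T s x| <= `|x|.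
Proof. by elim: s => //= i s; apply: le_trans; exact: contractionP. Qed.

Lemma comp_seq_isometry (R : realType) (H : hilbertType R) (I : eqType)
    (T : I -> {linear H -> H}) s :
  (forall i, is_isometry (T i)) -> is_isometry (comp_seq T s).
Proof. by move=> isoT x; elim: s => //= i s; rewrite isoT. Qed.

(** * Construction of the extension on the inverse limit along W^* *)

Theorem corollary8p11 (R : realType) (H : hilbertType R) (k : nat)
    (V : 'I_k -> {linear H -> H}) :
  (forall i : 'I_k, is_isometry (V i)) ->
  doubly_commuting V ->
  admits_unitary_extension V.
Proof.
move=> isoV dcV.
have commV i j x : V i (V j x) = V j (V i x).
  by have [->//|/dcV[+ _]] := eqVneq i j; exact.
have [A AE] := choice (fun i => isometry_adjoint_is_contraction (isoV i)).
have AP i x y : inner (V i x) y = inner x (A i y).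
  by rewrite AE isometry_adjointP.
have commA i j x : A i (A j x) = A j (A i x).
  by apply: inner_inj => u; rewrite -!AP commV.
have VK i : cancel (V i) (A i).
  by move=> x; rewrite AE isometry_adjointK.
(* [comp_seq V s] is W, and [prodA s] is the product of the V_i^*, that is W^*. *)
pose s := enum 'I_k.
have s_i i : i \in s by rewrite mem_enum.
pose prodA t := LinearContraction (@comp_seq_contraction R H _ A t).
have AprodA i t x : A i (prodA t x) = prodA t (A i x).
  exact: (comp_seq_comm (S := A i)).
have prodA_rem i x : A i (prodA (rem i s) x) = prodA s x.
  by rewrite [RHS](comp_seq_rem _ _ (s_i i)).
have [J JE isoJ] : exists2 J : {linear H -> invlim (prodA s)},
    (forall x n, J x n = iter n (comp_seq V s) x) & is_isometry J.
  apply: invlim_embed; first exact: comp_seq_isometry.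
  exact: comp_seq_cancel.
have exU i : exists U : {linear invlim (prodA s) -> invlim (prodA s)},
    (forall x n, U x n = prodA (rem i s) (x n.+1)) /\
    forall x, `|U x| <= `|x|.
  have [|U UE cU] := @invlim_lift _ _ (prodA s) (prodA (rem i s)) 1.
    by move=> x; exact: comp_seqC.
  by exists U.
have exU' i : exists U' : {linear invlim (prodA s) -> invlim (prodA s)},
    (forall x n, U' x n = A i (x n)) /\ forall x, `|U' x| <= `|x|.
  have [|U' UE cU] := @invlim_lift _ _ (prodA s) (A i) 0; last by exists U'.
  by move=> x; rewrite AprodA.
have [U UP] := choice exU; have [U' U'P] := choice exU'.
have UE i : forall x n, U i x n = prodA (rem i s) (x n.+1) := (UP i).1.
have U'E i : forall x n, U' i x n = A i (x n) := (U'P i).1.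
have uniU i : Defs.is_unitary (U i) /\ adjoint (U i) =1 U' i.
  apply: contraction_inverse_unitary; first exact: (UP i).2.
  - exact: (U'P i).2.
  (* In either order the composite has n-th term W^* x_(n+1), which is x_n by coherence. *)
  - by move=> x; apply: invlimP => n; rewrite U'E UE prodA_rem invlimS.
  - by move=> x; apply: invlimP => n; rewrite UE U'E -AprodA prodA_rem invlimS.
exists (invlim (prodA s)), J, U; split=> //.
- by move=> i; have [] := uniU i.
- move=> i j _; split=> x /=; apply: invlimP => n.
    by rewrite !UE; exact: comp_seqC.
  by rewrite !(uniU i).2 U'E !UE U'E AprodA.
- move=> i x /=; apply: invlimP => n; rewrite UE !JE iterS.
  (* W^(n+1) x is the product of the V_j, j != i, applied to V_i W^n x. The adjoint product cancels
     it, and V_i then moves past W^n. *)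
  rewrite (comp_seq_rem commV _ (s_i i)) (comp_seq_comm (S := V i))//.
  rewrite [LHS](comp_seq_cancel (T := V))//.
  by elim: n => //= n <-; rewrite (comp_seq_comm (S := V i)).
Qed.
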